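(* Let $\mathcal{H},\mathcal{K}$ be Hilbert spaces, let $\Phi_1,\ldots,\Phi_n:\mathcal{B}(\mathcal{H})\to\mathcal{B}(\mathcal{K})$ be positive linear mappings with $\sum_{i=1}^n\Phi_i(\mathbf{1}_{\mathcal{H}})=\mathbf{1}_{\mathcal{K}}$, and let $A_1,\ldots,A_n,B_1,\ldots,B_n\in\mathcal{B}(\mathcal{H})$ be self-adjoint operators with spectra contained in the interval $J$. If $f\in C^1_{\mathrm{co}}(J)$, then for any unit vector $x\in\mathcal{K}$, $$\begin{aligned} &\left\langle \sum_{i=1}^n\Phi_i(A_i)x,x\right\rangle\left\langle f'\left(\sum_{i=1}^n\Phi_i(B_i)\right)x,x\right\rangle-\left\langle f'\left(\sum_{i=1}^n\Phi_i(B_i)\right)\sum_{i=1}^n\Phi_i(B_i)x,x\right\rangle\\ &\le \left\langle\sum_{i=1}^n\Phi_i(f(A_i))x,x\right\rangle-\left\langle f\left(\sum_{i=1}^n\Phi_i(B_i)\right)x,x\right\rangle\\ &\le \left\langle\sum_{i=1}^n\Phi_i(f'(A_i)A_i)x,x\right\rangle-\left\langle\sum_{i=1}^n\Phi_i(f'(A_i))x,x\right\rangle\left\langle\sum_{i=1}^n\Phi_i(B_i)x,x\right\rangle. \end{aligned}$$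
   Context: $\mathcal{B}(\mathcal{H})$ is the $C^*$-algebra of bounded linear operators on a (complex) Hilbert space $\mathcal{H}$, with identity $\mathbf{1}_{\mathcal{H}}$. An operator $A$ is positive ($A\ge 0$) if $\langle Ax,x\rangle\ge 0$ for all $x\in\mathcal{H}$. A linear map $\Phi:\mathcal{B}(\mathcal{H})\to\mathcal{B}(\mathcal{K})$ is positive if $\Phi(A)\ge 0$ whenever $A\ge 0$. $C^1_{\mathrm{co}}(J)$ denotes the class of differentiable convex real functions on the interval $J\subseteq\mathbb{R}$ (one-sided derivatives at endpoints belonging to $J$); $f'$ is the derivative of $f$. For a self-adjoint operator $T$ with spectrum in $J$, $f(T)$ and $f'(T)$ are defined by the continuous functional calculus. *)

(* Defs.v *)
From HB Require Import structures.
From mathcomp Require Import all_boot all_order all_algebra.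
From mathcomp Require Import sesquilinear complex.
From mathcomp Require Import all_classical all_reals all_analysis.

Set Implicit Arguments.
Unset Strict Implicit.
Unset Printing Implicit Defensive.

Import Order.TTheory GRing.Theory Num.Theory.
Import numFieldNormedType.Exports.

Local Open Scope classical_set_scope.
Local Open Scope ring_scope.

(* [inner u v] is linear in [u] and conjugate-linear in [v].  The zero space
   is allowed. *)
HB.mixin Record NormedModule_isHilbert (R : realType) H
    of CompleteNormedModule R[i] H := {
  inner : {dot H for (@Num.conj R[i])} ;
  normr_inner : forall u : H, `|u| ^+ 2 = inner u u
}.

#[short(type="hilbertType")]
HB.structure Definition Hilbert (R : realType) :=
  {H of NormedModule_isHilbert R H & CompleteNormedModule R[i] H}.

Section BoundedOperators.
Variables (R : realType) (H : hilbertType R).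

Definition bounded_operator : {pred H -> H} := fun A =>
  `[< linear A /\ exists M : R[i], forall u : H, `|A u| <= M * `|u| >].

Lemma bounded_operatorP (A : H -> H) :
  reflect (linear A /\ exists M : R[i], forall u : H, `|A u| <= M * `|u|)
          (A \in bounded_operator).
Proof. exact: asboolP. Qed.

Lemma bounded_operator_submod : submod_closed bounded_operator.
Proof.
split.
  apply/bounded_operatorP; split.
    by move=> a u v; rewrite -[LHS]/(0 : H) -[RHS]/(a *: 0 + 0 : H) scaler0 addr0.
  by exists 0 => u; rewrite -[X in `|X|]/(0 : H) normr0 mul0r.
move=> a A B /bounded_operatorP[linA [M leM]] /bounded_operatorP[linB [N leN]].
apply/bounded_operatorP; split.
  move=> b u v; rewrite !fctE linA linB !scalerDr !scalerA.
  by rewrite [a * b]mulrC addrACA.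
exists (`|a| * M + N) => u; rewrite !fctE (le_trans (ler_normD _ _))//.
rewrite mulrDl lerD// normrZ -mulrA ler_wpM2l//.
Qed.

HB.instance Definition _ :=
  GRing.isSubmodClosed.Build R[i] (H -> H) bounded_operator
    bounded_operator_submod.

Record bop := Bop { bop_fun :> H -> H; _ : bop_fun \in bounded_operator }.

HB.instance Definition _ := [isSub for bop_fun].
HB.instance Definition _ := [Choice of bop by <:].
HB.instance Definition _ := [SubChoice_isSubLmodule of bop by <:].

Lemma bop_linear (A : bop) : linear A.
Proof. by case: A => A /= /bounded_operatorP[]. Qed.

Lemma bop_bounded (A : bop) : exists M : R[i], forall u : H, `|A u| <= M * `|u|.
Proof. by case: A => A /= /bounded_operatorP[]. Qed.

HB.instance Definition _ (A : bop) :=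
  GRing.isLinear.Build R[i] H H *:%R A (bop_linear A).

Lemma bop_ext (A B : bop) : (forall u, A u = B u) -> A = B.
Proof. by move=> AB; apply/val_inj/funext. Qed.

Lemma bop_id_subproof : (@id H) \in bounded_operator.
Proof.
by apply/bounded_operatorP; split=> //; exists 1 => u; rewrite mul1r.
Qed.

Definition bop_id : bop := Bop bop_id_subproof.

Lemma bop_comp_subproof (A B : bop) : (fun u => A (B u)) \in bounded_operator.
Proof.
apply/bounded_operatorP; split; first by move=> a u v; rewrite !linearP.
have [M leM] := bop_bounded A; have [N leN] := bop_bounded B.
have leM' u : `|A u| <= `|M| * `|u|.
  have [->|u0] := eqVneq u 0; first by rewrite linear0 !normr0 mulr0.
  rewrite (le_trans (leM u))// ler_wpM2r//.
  suff M0 : 0 <= M by rewrite ger0_norm.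
  by rewrite -(@pmulr_lge0 _ `|u|) ?normr_gt0// (le_trans _ (leM u)).
exists (`|M| * N) => u.
by rewrite (le_trans (leM' _))// -mulrA ler_wpM2l.
Qed.

Definition bop_comp (A B : bop) : bop := Bop (bop_comp_subproof A B).

Lemma bopDE (A B : bop) u : (A + B) u = A u + B u. Proof. by []. Qed.
Lemma bopZE (a : R[i]) (A : bop) u : (a *: A) u = a *: A u. Proof. by []. Qed.

Fact bop_compA : associative bop_comp.
Proof. by move=> A B C; exact: bop_ext. Qed.
Fact bop_comp1l : left_id bop_id bop_comp.
Proof. by move=> A; exact: bop_ext. Qed.
Fact bop_comp1r : right_id bop_id bop_comp.
Proof. by move=> A; exact: bop_ext. Qed.
Fact bop_compDl : left_distributive bop_comp +%R.
Proof. by move=> A B C; exact: bop_ext. Qed.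
Fact bop_compDr : right_distributive bop_comp +%R.
Proof. by move=> A B C; apply: bop_ext => u; exact: linearD. Qed.

(* In the ring [bop], [A * B] is composition and [1] is the identity operator. *)
HB.instance Definition _ := GRing.Zmodule_isPzRing.Build bop
  bop_compA bop_comp1l bop_comp1r bop_compDl bop_compDr.

Lemma bopNE (A : bop) u : (- A) u = - A u. Proof. by []. Qed.
Lemma bopME (A B : bop) u : (A * B) u = A (B u). Proof. by []. Qed.
Lemma bop1E u : (1 : bop) u = u. Proof. by []. Qed.

Implicit Types (A T S : bop) (f : R -> R) (J : interval R).

Definition self_adjoint A := forall u v : H, inner (A u) v = inner u (A v).

(* In [R[i]], [0 <= z] says that [z] is real and nonnegative. *)
Definition positive_bop A := forall u : H, 0 <= inner (A u) u.

Definition spectrum T : set R[i] :=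
  [set z : R[i] | ~ exists S,
     S * (z *: (1 : bop) - T) = 1 /\ (z *: (1 : bop) - T) * S = 1].

Definition spectrum_in T J :=
  spectrum T `<=` [set t%:C%C | t in [set` J]].

Definition poly_bop (p : {poly R}) T : bop :=
  \sum_(i < size p) (p`_i)%:C%C *: T ^+ i.

(* [S] is the limit in operator norm of [p_n(T)], for some real polynomials
   [p_n] converging to [f] uniformly on the (real) spectrum of [T]. *)
Definition is_cfc f T S := exists p : nat -> {poly R},
  (forall e : R, 0 < e -> \forall n \near \oo,
     forall t : R, spectrum T t%:C%C -> `|f t - (p n).[t]| <= e) /\
  (forall e : R, 0 < e -> \forall n \near \oo,
     forall u : H, `|S u - poly_bop (p n) T u| <= e%:C%C * `|u|).

(* Continuous functional calculus [f(T)]: for [T] self-adjoint and [f]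
   continuous on the spectrum of [T], there is exactly one [S] such that
   [is_cfc f T S].  The value is unspecified for other arguments. *)
Definition cfc f T : bop := xget 0 [set S | is_cfc f T S].

End BoundedOperators.

Arguments bop {R} H.

Definition positive_map (R : realType) (H K : hilbertType R)
    (Phi : bop H -> bop K) :=
  forall A : bop H, positive_bop A -> positive_bop (Phi A).

Section DerivativeOnInterval.
Variables (R : realType) (J : interval R) (f : R -> R).

(* Points approach [x] from inside [J] only, so this is the usual derivative
   in the interior and the one-sided derivative at an endpoint in [J]. *)
Definition diff_quot (x : R) : set_system R :=
  (fun y => (f y - f x) / (y - x)) @ within [set` J] x^'.

Definition differentiable_on := forall x, x \in J -> cvg (diff_quot x).

Definition deriv_on (x : R) : R := lim (diff_quot x).

Definition C1co := differentiable_on /\ convex_function ([set` J] : set R) f.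

End DerivativeOnInterval.

(* Main.v *)
Require Import Defs.
From HB Require Import structures.
From mathcomp Require Import all_boot all_order all_algebra.
From mathcomp Require Import sesquilinear complex.
From mathcomp Require Import all_classical all_reals all_analysis.
From mathcomp Require Import ring lra.

(* For a differentiable convex f and s, t in J, f(t) + f'(t)(s - t) <= f(s).
   Fix s and apply the functional calculus in t, at PB := sum_i Phi_i(B_i) for
   the first inequality and at the A_i for the second; pairing with x (after
   applying the Phi_i and summing, in the second case) leaves a scalar bound
   [a + b s <= f(s)] valid for all s in J.  Apply the functional calculus again,
   now in s, at the A_i resp. at PB, and pair with x: no Jensen inequality is
   needed.

   The functional calculus is monotone because p >= 0 on the spectrum of T gives
   p(T) >= 0: the infimum of the numerical range of p(T) lies in the spectrum of
   p(T), which is the image by p of the spectrum of T.  It is defined at f and f'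
   by Weierstrass' theorem, f' being continuous by convexity. *)

Set Implicit Arguments.
Unset Strict Implicit.
Unset Printing Implicit Defensive.

Import Order.TTheory GRing.Theory Num.Theory.
Import numFieldNormedType.Exports.

Local Open Scope classical_set_scope.
Local Open Scope ring_scope.

(** * Polynomial approximation *)

Section Weierstrass.
Context {R : realType}.
Implicit Types (f : R -> R) (h : nat -> R) (b c e x y : R).

(* [bernstein n h] is the sum over k of h k C(n, k) X^k (1 - X)^(n - k). *)
Fixpoint bernstein n h : {poly R} :=
  if n is m.+1 then (1 - 'X) * bernstein m h + 'X * bernstein m (h \o S)
  else (h 0%N)%:P.

(* [(a + n x)^2 + n x (1 - x)] is the Bernstein polynomial of the sequence
   [(k + a)^2]. *)
Lemma bernstein_dist_le n h x y (a d e : R) : 0 <= x <= 1 -> 0 <= d ->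
  (forall k, (k <= n)%N -> `|h k - y| <= e + d * (k%:R + a) ^+ 2) ->
  `|(bernstein n h).[x] - y| <= e + d * ((a + n%:R * x) ^+ 2 + n%:R * x * (1 - x)).
Proof.
move=> /andP[x0 x1] d0; elim: n h a => [|n IHn] h a hP /=.
  by rewrite hornerC !mul0r !addr0; have := hP 0%N isT; rewrite add0r.
have H1 := IHn h a (fun k kn => hP k (leqW kn)).
have {}H2 : `|(bernstein n (h \o S)).[x] - y| <=
    e + d * ((a + 1 + n%:R * x) ^+ 2 + n%:R * x * (1 - x)).
  by apply: IHn => k kn /=; have := hP k.+1 kn; rewrite -natr1 -addrA [1 + a]addrC.
rewrite !hornerE.
rewrite (_ : _ - y = (1 - x) * ((bernstein n h).[x] - y)
  + x * ((bernstein n (h \o S)).[x] - y)); last by ring.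
apply: le_trans (ler_normD _ _) _; rewrite !normrM (ger0_norm x0) ger0_norm ?subr_ge0//.
have x1' : 0 <= 1 - x by rewrite subr_ge0.
apply: le_trans (lerD (ler_wpM2l x1' H1) (ler_wpM2l x0 H2)) _.
by rewrite le_eqVlt -natr1; apply/orP; left; apply/eqP; ring.
Qed.

Lemma within_itv_continuousP b c f : {within `[b, c], continuous f} <->
  forall x, x \in `[b, c] -> forall e, 0 < e ->
    exists2 d : R, 0 < d &
      forall y, y \in `[b, c] -> `|y - x| < d -> `|f y - f x| <= e.
Proof.
split=> [fc x xI e e0|fP].
  have /subspace_continuousP/(_ x xI)/cvgrPdist_le/(_ _ e0) := fc.
  move/nbhs_ballP => [d /= d0 dP]; exists d => // y yI yx.
  by rewrite distrC; apply: dP => //=; rewrite /ball /= distrC.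
apply/subspace_continuousP => x xI; apply/cvgrPdist_le => e e0.
have [d d0 dP] := fP x xI e e0.
apply/nbhs_ballP; exists d => //= y; rewrite /ball /= distrC => yx yI.
by rewrite distrC; exact: dP.
Qed.

(** Heine-Cantor. [P d x] says that the radius d serves at x; it holds for small d uniformly near
    each x, and compactness in its near-covering form gives one d for the whole segment. *)
Lemma segment_unif_continuous b c f e : {within `[b, c], continuous f} -> 0 < e ->
  exists2 d : R, 0 < d &
    {in `[b, c] &, forall x y, `|x - y| < d -> `|f x - f y| <= e}.
Proof.
move=> /within_itv_continuousP fc e0.
have := @segment_compact R b c; rewrite compact_near_coveringP.
pose P (d x : R) := x \in `[b, c] ->
  forall y, y \in `[b, c] -> `|x - y| < d -> `|f x - f y| <= e.
move=> /(_ _ (0^'+) P _) H; have {}H : \forall d \near 0^'+, `[b, c] `<=` P d.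
  apply: H => x xI; have [|d d0 dP] := fc x xI (e / 2); first by rewrite divr_gt0.
  exists ([set t | `|t - x| < d / 2], [set r | r < d / 2]); first split => /=.
  + apply/nbhs_ballP; exists (d / 2) => /=; first by rewrite divr_gt0.
    by move=> t; rewrite /ball /= distrC.
  + have d2 : 0 < d / 2 by rewrite divr_gt0.
    by have := nbhs_right_lt d2.
  move=> [t r] /= [tx rd] tI y yI ty.
  have Ht : `|f t - f x| <= e / 2 by apply: dP => //; lra.
  have Hy : `|f y - f x| <= e / 2.
    apply: dP => //; rewrite (le_lt_trans (ler_distD t _ _))// distrC; lra.
  by rewrite (le_trans (ler_distD (f x) _ _))// [leRHS]splitr lerD// distrC.
have /filter_ex[d [dP d0]] :=
  @filterI _ (0^'+) (at_right_proper_filter 0) _ _ H (nbhs_right_gt 0).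
by exists d => // x y xI yI; exact: dP.
Qed.

(** Bernstein polynomials, after rescaling the segment to [0, 1]. Uniform continuity and boundedness
    control the oscillation of f by e/2 plus a multiple of the squared distance, which
    [bernstein_dist_le] turns into an error e/2 + O(1/n). *)
Lemma weierstrass b c f e : {within `[b, c], continuous f} -> 0 < e ->
  exists p : {poly R}, {in `[b, c], forall x, `|f x - p.[x]| <= e}.
Proof.
move=> fc e0.
have [cb|bc|->] := ltgtP c b; first 1 last.
- have [d d0 dP] := segment_unif_continuous fc (divr_gt0 e0 (ltr0Sn _ 1)).
  have [M [_ /(_ (M + 1))]] :=
    compact_bounded (continuous_compact fc (@segment_compact R b c)).
  rewrite ltrDl => /(_ ltr01) HM.
  have {}fM x : x \in `[b, c] -> `|f x| <= M + 1.
    by move=> xI; apply: HM; exists x.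
  have {HM} M0 : 0 <= M + 1.
    by apply: le_trans (fM b _) => //; rewrite in_itv /= lexx ltW.
  pose w := c - b; have w0 : 0 < w by rewrite subr_gt0.
  (* For points at distance at least d, [D * (x - y) ^+ 2] is at least [2 * (M + 1)] and so
     dominates [|f x - f y|]; for closer points e/2 suffices. *)
  pose D := 2 * (M + 1) / d ^+ 2.
  have D0 : 0 <= D.
    by apply: divr_ge0; [exact: mulr_ge0|exact: sqr_ge0].
  have fD x y : x \in `[b, c] -> y \in `[b, c] -> `|f x - f y| <= e / 2 + D * (x - y) ^+ 2.
    move=> xI yI; have [xy|xy] := ltP `|x - y| d.
      by rewrite (le_trans (dP _ _ xI yI xy))// lerDl mulr_ge0// sqr_ge0.
    apply: (@le_trans _ _ (2 * (M + 1))).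
      by rewrite (le_trans (ler_normB _ _))// mulr_natl mulr2n lerD// fM.
    apply: ler_wpDl; first by rewrite divr_ge0// ltW.
    rewrite /D -mulrA ler_peMr ?mulr_ge0// ler_pdivlMl ?exprn_gt0// mulr1.
    by rewrite -[leRHS]real_normK ?num_real// ler_pXn2r// nnegrE// ltW.
  have [n n0 nP] : exists2 n : nat, 0 < n%:R :> R & D * w ^+ 2 / n%:R <= e / 2.
    exists (Num.truncn (2 * D * w ^+ 2 / e)).+1; rewrite ?ltr0n// ler_pdivrMr//.
    have := truncnS_gt (2 * D * w ^+ 2 / e).
    by rewrite ltr_pdivrMr//; lra.
  exists (bernstein n (fun k => f (b + w * (k%:R / n%:R))) \Po (w^-1 *: ('X - b%:P))).
  move=> s sI; pose x := w^-1 * (s - b).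
  rewrite horner_comp (_ : (_ *: _).[s] = x); last by rewrite !hornerE.
  have sE : s = b + w * x by rewrite /x mulrA divff ?mul1r ?gt_eqF//; ring.
  have x01 : 0 <= x <= 1.
    move: sI; rewrite sE in_itv /= lerDl pmulr_rge0// => /andP[-> H] /=.
    by rewrite -(ler_pM2l w0) mulr1 [leRHS]/(c - b) lerBrDl.
  have DW : 0 <= D * w ^+ 2 / n%:R ^+ 2.
    by apply: divr_ge0; [apply: mulr_ge0 => //|]; exact: sqr_ge0.
  (* Taking [a = - n x] centres the quadratic at the mean n x, so that only the variance n x (1 - x)
     survives. *)
  rewrite distrC; apply: le_trans
    (@bernstein_dist_le n _ x (f s) (- (n%:R * x)) _ (e / 2) x01 DW _) _.
    move=> k kn; have kI : b + w * (k%:R / n%:R) \in `[b, c].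
      rewrite in_itv /= lerDl mulr_ge0 ?divr_ge0 ?(ltW w0)//=.
      by rewrite -lerBrDl -/w ler_piMr ?(ltW w0)// ler_pdivrMr// mul1r ler_nat.
    apply: le_trans (fD _ _ kI sI) _; rewrite sE lerD2l.
    rewrite le_eqVlt; apply/orP; left; apply/eqP.
    by field; exact: lt0r_neq0.
  rewrite addNr expr0n /= add0r [leRHS]splitr lerD2l; apply: le_trans nP.
  rewrite [leLHS](_ : _ = D * w ^+ 2 / n%:R * (x * (1 - x))); last by field; exact: lt0r_neq0.
  apply: ler_piMr.
    by apply: divr_ge0; [apply: mulr_ge0 => //; exact: sqr_ge0|exact: ltW].
  by case/andP: x01 => *; nra.
- exists (f b)%:P => x; rewrite in_itv /= -eq_le => /eqP <-.
  by rewrite hornerC subrr normr0 ltW.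
- exists 0 => x; rewrite in_itv /= => /andP[bx xc].
  by have := le_lt_trans (le_trans bx xc) cb; rewrite ltxx.
Qed.
End Weierstrass.

(** * Differentiable convex functions *)

Section ConvexDerivative.
Context {R : realType}.
Variables (J : interval R) (f : R -> R).
Hypothesis f_C1co : C1co J f.
Local Notation f' := (deriv_on J f).

Lemma diff_quot_dist x e : x \in J -> 0 < e -> exists2 d : R, 0 < d &
  forall y, y \in J -> y != x -> `|y - x| < d ->
    `|(f y - f x) / (y - x) - f' x| <= e.
Proof.
move=> xJ e0; have : diff_quot J f x --> f' x by exact: f_C1co.1.
move=> /cvgrPdist_le/(_ _ e0); rewrite /diff_quot /= => /nbhs_ballP[d /= d0 dP].
exists d => // y yJ yx dyx; rewrite distrC.
by apply: dP => //; rewrite /ball /= distrC.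
Qed.

Lemma convex_on x y (t : R) : x \in J -> y \in J -> 0 <= t <= 1 ->
  f (x + t * (y - x)) <= f x + t * (f y - f x).
Proof.
move=> xJ yJ /andP[t0 t1].
have : f (t * y + (1 - t) * x) <= t * f y + (1 - t) * f x.
  by apply: (f_C1co.2 (Itv01 t0 t1) y x); exact: mem_set.
by rewrite (_ : t * y + _ = x + t * (y - x)); [lra|ring].
Qed.

(** If f y fell below the tangent at x, convexity would keep f below that tangent by a fixed
    proportion of the distance all along the chord, against the convergence of the difference
    quotients to [f' x]. *)
Lemma tangent_le x y : x \in J -> y \in J -> f x + f' x * (y - x) <= f y.
Proof.
move=> xJ yJ; have [->|yx] := eqVneq y x; first by rewrite subrr mulr0 addr0.
rewrite leNgt; apply/negP => lt_f.
pose r := `|y - x|; have r0 : 0 < r by rewrite normr_gt0 subr_eq0.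
(* Half the slope deficit of the chord: at z convexity forces a deficit of at least [2 * e * t * r],
   while the difference quotient allows at most [e * t * r]. *)
pose e := (f x + f' x * (y - x) - f y) / (2 * r).
have e0 : 0 < e by rewrite divr_gt0 ?mulr_gt0// subr_gt0.
have [d d0 dP] := diff_quot_dist xJ e0.
(* Keeps z on the segment from x to y and within d of x. *)
pose t := Num.min 1 (d / (2 * r)).
have t0 : 0 < t by rewrite lt_min ltr01 divr_gt0// mulr_gt0.
have t1 : t <= 1 by rewrite ge_min lexx.
have td : t * r < d.
  apply: (@le_lt_trans _ _ (d / 2)); last by rewrite ltr_pdivrMr//; lra.
  rewrite -ler_pdivlMr// ge_min; apply/orP; right.
  by rewrite invfM mulrA.
pose z := x + t * (y - x).
have zx : z - x = t * (y - x) by rewrite /z addrC addKr.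
have zJ : z \in J.
  have : [set` J] z.
    have [xy|xy] := leP x y.
      by apply: (interval_is_interval xJ yJ); rewrite /z; nra.
    by apply: (interval_is_interval yJ xJ); rewrite /z; nra.
  by [].
have zx0 : z - x != 0 by rewrite zx mulf_neq0 ?subr_eq0// lt0r_neq0.
have := dP z zJ _ _; rewrite -subr_eq0 zx0 zx normrM (gtr0_norm t0) -/r => /(_ isT td).
have H : f z <= f x + t * (f y - f x) by apply: convex_on; rewrite // ltW.
move=> H2.
have : `|(f z - f x) - f' x * (t * (y - x))| <= e * (t * r).
  rewrite [X in `|X|](_ : _ = ((f z - f x) / (t * (y - x)) - f' x) * (t * (y - x))).
    by rewrite normrM normrM (gtr0_norm t0) ler_wpM2r// mulr_ge0// ltW.
  by rewrite mulrBl divfK// -zx.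
rewrite ler_norml => /andP[H3 _].
have : e * (t * r) = t * (f x + f' x * (y - x) - f y) / 2.
  by rewrite /e; field; exact: lt0r_neq0.
move=> H4; rewrite H4 in H3; nra.
Qed.

(** The tangent inequalities at x and at y add up to [(f' y - f' x) * (y - x) >= 0]. *)
Lemma deriv_on_le x y : x \in J -> y \in J -> x <= y -> f' x <= f' y.
Proof.
move=> xJ yJ; rewrite le_eqVlt => /predU1P[->//|xy].
have := tangent_le xJ yJ; have := tangent_le yJ xJ; nra.
Qed.

Lemma itv_segment (b c x : R) : b \in J -> c \in J -> x \in `[b, c] -> x \in J.
Proof.
by move=> bJ cJ; rewrite in_itv /=; exact: (interval_is_interval bJ cJ).
Qed.

(** f is Lipschitz on the segment: f' stays between [f' b] and [f' c], and the tangents at x and y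
    bound [f y - f x] from both sides. *)
Lemma C1co_continuous b c : b \in J -> c \in J -> {within `[b, c], continuous f}.
Proof.
move=> bJ cJ; apply/within_itv_continuousP => x xI e e0.
have inJ := itv_segment bJ cJ.
pose L := 1 + `|f' b| + `|f' c|.
have L0 : 0 < L by rewrite /L -addrA ltr_pwDl// addr_ge0.
have fL z : z \in `[b, c] -> `|f' z| <= L.
  move=> zI; have := zI; rewrite in_itv /= => /andP[bz zc].
  have H1 := deriv_on_le bJ (inJ z zI) bz.
  have H2 := deriv_on_le (inJ z zI) cJ zc.
  have := ler_norm (- f' b); rewrite normrN; have := ler_norm (f' c).
  have := normr_ge0 (f' b); have := normr_ge0 (f' c).
  by rewrite ler_norml /L => *; apply/andP; split; lra.
exists (e / L); first exact: divr_gt0.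
move=> y yI; rewrite ltr_pdivlMr// => yx.
have H1 := tangent_le (inJ x xI) (inJ y yI).
have H2 := tangent_le (inJ y yI) (inJ x xI).
have P z : z \in `[b, c] -> `|f' z * (y - x)| <= e.
  move=> zI; rewrite normrM; have := fL z zI; have := normr_ge0 (y - x); nra.
have := P x xI; have := P y yI; rewrite !ler_norml => /andP[? ?] /andP[? ?].
by apply/andP; split; lra.
Qed.

(** Since f' is monotone, only jumps have to be excluded: a jump at x would make f leave its tangent
    at x faster than differentiability allows. *)
Lemma deriv_on_continuous b c : b \in J -> c \in J ->
  {within `[b, c], continuous f'}.
Proof.
move=> bJ cJ; apply/within_itv_continuousP => x xI e e0.
have inJ := itv_segment bJ cJ; have xJ := inJ x xI.
have [d d0 dP] := diff_quot_dist xJ (divr_gt0 e0 (ltr0Sn _ 1)).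
(* Chains the tangent at x evaluated at z with the tangent at z evaluated at y, and compares the
   result with the first-order expansion of f at x. *)
have key y z : y \in J -> z \in J -> y != x -> `|y - x| < d ->
    (f' z - f' x) * (y - z) <= e / 2 * `|y - x|.
  move=> yJ zJ yx dyx; have yx0 : y - x != 0 by rewrite subr_eq0.
  have : `|(f y - f x) - f' x * (y - x)| <= e / 2 * `|y - x|.
    rewrite [X in `|X|](_ : _ = ((f y - f x) / (y - x) - f' x) * (y - x)).
      by rewrite normrM ler_wpM2r// dP.
    by rewrite mulrBl divfK.
  rewrite ler_norml => /andP[_ H].
  have := tangent_le zJ yJ; have := tangent_le xJ zJ; nra.
have right : exists2 d' : R, 0 < d' &
    forall z, z \in J -> x < z -> `|z - x| < d' -> f' z <= f' x + e.
  (* If J has no point within d to the right of x, the claim is vacuous. Otherwise one such y is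
     fixed and z stays in the first half of the way to it, so that y - z is at least half of y -
     x. *)
  have [[y yJ [xy dyx]]|H] := pselect (exists2 y, y \in J & x < y /\ `|y - x| < d).
    exists ((y - x) / 2); first by rewrite divr_gt0// subr_gt0.
    move=> z zJ xz; rewrite gtr0_norm ?subr_gt0// => zx.
    have := key y z yJ zJ (negbT (gt_eqF xy)) dyx.
    rewrite gtr0_norm ?subr_gt0//; nra.
  exists d => // z zJ xz dzx; exfalso; apply: H; exists z => //.
have left : exists2 d' : R, 0 < d' &
    forall z, z \in J -> z < x -> `|z - x| < d' -> f' x - e <= f' z.
  have [[y yJ [xy dyx]]|H] := pselect (exists2 y, y \in J & y < x /\ `|y - x| < d).
    exists ((x - y) / 2); first by rewrite divr_gt0// subr_gt0.
    move=> z zJ xz; rewrite distrC gtr0_norm ?subr_gt0// => zx.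
    have := key y z yJ zJ (negbT (lt_eqF xy)) dyx.
    rewrite distrC gtr0_norm ?subr_gt0//; nra.
  exists d => // z zJ xz dzx; exfalso; apply: H; exists z => //.
have [d1 d10 d1P] := right; have [d2 d20 d2P] := left.
exists (Num.min d1 d2); first by rewrite lt_min d10.
move=> y yI; rewrite lt_min => /andP[yd1 yd2]; have yJ := inJ y yI.
rewrite ler_norml; have [yx|xy|->] := ltgtP y x; last by lra.
- have := d2P y yJ yx yd2; have := deriv_on_le yJ xJ (ltW yx); lra.
- have := d1P y yJ xy yd1; have := deriv_on_le xJ yJ (ltW xy); lra.
Qed.

End ConvexDerivative.

(** * Operators on a Hilbert space *)

Section Inner.
Context {R : realType} {H : hilbertType R}.
Implicit Types (u v w : H) (a : R[i]) (T S A B : bop H).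

Lemma inner_conj u v : inner u v = (inner v u)^*.
Proof. by rewrite hermC expr0 mul1r. Qed.

Lemma innerDl u v w : inner (u + v) w = inner u w + inner v w.
Proof. exact: linearDl. Qed.

Lemma innerBl u v w : inner (u - v) w = inner u w - inner v w.
Proof. exact: linearBl. Qed.

Lemma innerNl u v : inner (- u) v = - inner u v.
Proof. exact: linearNl. Qed.

Lemma innerNr u v : inner u (- v) = - inner u v.
Proof. exact: linearNr. Qed.

Lemma innerZl a u v : inner (a *: u) v = a * inner u v.
Proof. exact: linearZl_LR. Qed.

Lemma innerDr u v w : inner w (u + v) = inner w u + inner w v.
Proof. exact: linearDr. Qed.

Lemma innerBr u v w : inner w (u - v) = inner w u - inner w v.
Proof. exact: linearBr. Qed.

Lemma innerZr a u v : inner v (a *: u) = a^* * inner v u.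
Proof. exact: linearZr_LR. Qed.

(** With d = <v, v> and a = <u, v>, the squared norm of [d *: u - a *: v] expands to d (d <u, u> -
    |a|^2). *)
Lemma Cauchy_Schwarz u v : `|inner u v| <= `|u| * `|v|.
Proof.
have [->|v0] := eqVneq v 0; first by rewrite linear0r !normr0 mulr0.
rewrite -(@ler_pXn2r _ 2)// ?nnegrE ?mulr_ge0// exprMn !normr_inner.
have d0 : 0 < inner v v by rewrite -normr_inner exprn_gt0// normr_gt0.
pose d := inner v v; pose a := inner u v.
have dC : d^* = d by rewrite conj_Creal// gtr0_real.
have : 0 <= inner (d *: u - a *: v) (d *: u - a *: v).
  by rewrite -normr_inner exprn_ge0.
rewrite innerBl !innerBr !innerZl !innerZr dC -/a -/d (inner_conj v u) -/a.
rewrite (_ : _ - _ = d * (inner u u * d - a * a^*)); last by ring.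
by rewrite pmulr_rge0// subr_ge0 normCK.
Qed.

Lemma bop_appD T u v : T (u + v) = T u + T v.
Proof. exact: linearD. Qed.

Lemma bop_appB T u v : T (u - v) = T u - T v.
Proof. exact: linearB. Qed.

Lemma bop_appZ T a u : T (a *: u) = a *: T u.
Proof. exact: linearZ_LR. Qed.

Lemma self_adjoint_real T u : self_adjoint T -> inner (T u) u \is Num.real.
Proof. by move=> Tsa; apply/CrealP; rewrite -inner_conj Tsa. Qed.

(* Polarization. *)
Lemma real_self_adjoint T :
  (forall u, inner (T u) u \is Num.real) -> self_adjoint T.
Proof.
move=> rT u v; rewrite [RHS]inner_conj.
have real w : (inner (T w) w)^* = inner (T w) w by exact/CrealP.
have := real (u + v); have := real (u + 'i *: v).
rewrite !bop_appD bop_appZ !innerDl !innerDr !innerZl.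
rewrite !innerZr !rmorphD !rmorphM /= !conjCK !real !conjCi.
set X := inner (T u) v; set Y := inner (T v) u => Ei E1.
have {}Ei : 'i * (X + X^* - Y - Y^*) = 0 :> R[i].
  by move/eqP: Ei; rewrite -subr_eq0 => /eqP <-; ring.
have {}E1 : X^* + Y^* - X - Y = 0.
  by move/eqP: E1; rewrite -subr_eq0 => /eqP <-; ring.
have {}Ei : X + X^* - Y - Y^* = 0 by apply/eqP; move/eqP: Ei; rewrite mulf_eq0 (negPf (neq0Ci _)).
have : 2 * (X - Y^*) = 0 by rewrite -(subr0 0) -{1}Ei -E1; ring.
by move/eqP; rewrite mulf_eq0 pnatr_eq0 /= subr_eq0 => /eqP.
Qed.

Lemma positive_self_adjoint T : positive_bop T -> self_adjoint T.
Proof. by move=> T0; apply: real_self_adjoint => u; exact: ger0_real. Qed.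

(** Chosen so that [spectrum T z] is by conversion the negation of [bop_inv (z *: 1 - T)]. *)
Definition bop_inv T := exists S, S * T = 1 /\ T * S = 1.

Lemma bop_scaleAl a A B : (a *: A) * B = a *: (A * B).
Proof. exact: bop_ext. Qed.

Lemma bop_scaleAr a A B : A * (a *: B) = a *: (A * B).
Proof. by apply: bop_ext => u; exact: linearZ_LR. Qed.

Lemma bop_invM A B : bop_inv A -> bop_inv B -> bop_inv (A * B).
Proof.
move=> [A' [A1 A2]] [B' [B1 B2]]; exists (B' * A'); split.
  by rewrite -mulrA (mulrA A') A1 mul1r.
by rewrite -mulrA (mulrA B) B2 mul1r.
Qed.

Lemma bop_invZ a A : a != 0 -> bop_inv A -> bop_inv (a *: A).
Proof.
move=> a0 [A' [A1 A2]]; exists (a^-1 *: A').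
by rewrite !bop_scaleAl !bop_scaleAr !scalerA A1 A2 divff// mulVf// !scale1r.
Qed.

(** The inverse S of A B commutes with B, so [S * B] inverts A on both sides. *)
Lemma bop_inv_factor A B : A * B = B * A -> bop_inv (A * B) -> bop_inv A.
Proof.
move=> AB [S [S1 S2]].
have SB : S * B = B * S.
  by rewrite -[LHS]mulr1 -S2 !mulrA -(mulrA S B A) -AB S1 mul1r.
by exists (S * B); split; [rewrite -mulrA -AB S1|rewrite SB mulrA S2].
Qed.

Lemma self_adjointD A B : self_adjoint A -> self_adjoint B -> self_adjoint (A + B).
Proof. by move=> sA sB u v; rewrite !bopDE innerDl innerDr sA sB. Qed.

Lemma self_adjointN A : self_adjoint A -> self_adjoint (- A).
Proof. by move=> sA u v; rewrite !bopNE innerNl innerNr sA. Qed.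

Lemma self_adjointZ (c : R) A : self_adjoint A -> self_adjoint (c%:C%C *: A).
Proof.
by move=> sA u v; rewrite !bopZE innerZl innerZr sA conj_Creal//; apply/complex_realP; exists c.
Qed.

Lemma self_adjoint1 : self_adjoint (1 : bop H). Proof. by []. Qed.

Lemma self_adjointX A n : self_adjoint A -> self_adjoint (A ^+ n).
Proof.
move=> sA; elim: n => [|n IHn]; first exact: self_adjoint1.
by move=> u v; rewrite {1}exprS exprSr !bopME sA IHn.
Qed.

Lemma poly_bop_self_adjoint p T : self_adjoint T -> self_adjoint (poly_bop p T).
Proof.
move=> sT; rewrite /poly_bop; elim/big_ind: _ => [u v|A B|i _].
- by rewrite linear0l linear0r.
- exact: self_adjointD.
- exact/self_adjointZ/self_adjointX.
Qed.

Lemma positiveD A B : positive_bop A -> positive_bop B -> positive_bop (A + B).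
Proof. by move=> pA pB u; rewrite bopDE innerDl addr_ge0. Qed.

Lemma positiveZ a A : 0 <= a -> positive_bop A -> positive_bop (a *: A).
Proof. by move=> a0 pA u; rewrite bopZE innerZl mulr_ge0. Qed.

Lemma positive1 : positive_bop (1 : bop H).
Proof. by move=> u; rewrite -normr_inner exprn_ge0. Qed.

Lemma bop_bounded_pos T : exists2 M : R, 0 < M & forall u, `|T u| <= M%:C%C * `|u|.
Proof.
have [M leM] := bop_bounded T.
have [m mE] : exists m : R, `|M| = m%:C%C by apply/complex_realP/normr_real.
have m0 : 0 <= m by rewrite -ler0c -mE.
exists (m + 1); first by rewrite ltr_pwDr.
move=> u; rewrite rmorphD rmorph1 /= -mE mulrDl mul1r.
apply: ler_wpDr => //; apply: le_trans (leM u) _.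
(* On the zero space M may be any complex number; what is known to be nonnegative is the product. *)
have : 0 <= M * `|u| by exact: le_trans (leM u).
by move=> /ger0_norm <-; rewrite normrM normr_id.
Qed.

End Inner.

(** Operator bounds b <= T <= c are expressed below as positivity of [T - b%:B] and of
    [c%:B - T]. *)
Definition bop_scalar {R : realType} {H : hilbertType R} (c : R) : bop H :=
  c%:C%C *: (1 : bop H).

Local Notation "c %:B" := (bop_scalar c) (at level 2, format "c %:B").

(** * Numerical range, completeness and invertibility of operators *)

Section Spectrum.
Context {R : realType} {H : hilbertType R}.
Implicit Types (u v w : H) (a : R[i]) (T S A B : bop H) (c m M N : R).

Lemma bop_scalarE c u : c%:B u = c%:C%C *: u. Proof. by []. Qed.

Lemma ge_scalarP c T : positive_bop (T - c%:B) <->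
  forall u, c%:C%C * `|u| ^+ 2 <= inner (T u) u.
Proof.
split=> pT u; have := pT u;
by rewrite bopDE bopNE bop_scalarE innerBl innerZl subr_ge0 normr_inner.
Qed.

Lemma ge_scalar_unit c T :
  (forall u, `|u| = 1 -> c%:C%C <= inner (T u) u) -> positive_bop (T - c%:B).
Proof.
move=> pT; apply/ge_scalarP => u.
have [->|u0] := eqVneq u 0; first by rewrite linear0r normr0 expr0n mulr0.
have nu0 : 0 < `|u| by rewrite normr_gt0.
have := pT (`|u|^-1 *: u); rewrite normrZ normfV normr_id mulVf ?gt_eqF// => /(_ erefl).
rewrite bop_appZ innerZl innerZr conj_Creal ?rpredV ?normr_real// mulrA -expr2.
by rewrite exprVn mulrC ler_pdivlMr// exprn_gt0.
Qed.

Lemma self_adjoint_bound M T : self_adjoint T ->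
  (forall u, `|T u| <= M%:C%C * `|u|) ->
  positive_bop (M%:B - T) /\ positive_bop (T + M%:B).
Proof.
move=> sT TM.
have le u : `|inner (T u) u| <= M%:C%C * inner u u.
  rewrite (le_trans (Cauchy_Schwarz _ _))// -normr_inner expr2 mulrA.
  by rewrite ler_wpM2r.
have le' u : - (M%:C%C * inner u u) <= inner (T u) u <= M%:C%C * inner u u.
  by rewrite -real_ler_norml ?self_adjoint_real.
split=> u; have /andP[l1 l2] := le' u.
  by rewrite bopDE bopNE bop_scalarE innerBl innerZl subr_ge0.
by rewrite bopDE bop_scalarE innerDl innerZl -lerBlDr sub0r.
Qed.

(* [N (N T - T ^ 2) = T (N - T) T + (N - T) T (N - T)]. *)
Lemma positive_norm_sq N T : 0 < N -> positive_bop T ->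
  positive_bop (N%:B - T) ->
  forall u, `|T u| ^+ 2 <= N%:C%C * inner (T u) u.
Proof.
move=> N0 pT pN u; have sT := positive_self_adjoint pT.
have := addr_ge0 (pN (T u)) (pT (N%:C%C *: u - T u)).
have NC : N%:C%C^* = N%:C%C by rewrite conj_Creal//; apply/complex_realP; exists N.
rewrite bopDE bopNE bop_scalarE bop_appB bop_appZ.
rewrite !innerBl !innerBr !innerZl !innerZr NC normr_inner.
rewrite (sT (T u) u) [leRHS](_ : _ = N%:C%C * (N%:C%C * inner (T u) u - inner (T u) (T u))).
  by rewrite pmulr_rge0 ?subr_ge0// (ltcR 0).
by move: (N%:C%C : R[i]) (inner (T (T u)) (T u)) => z w; ring.
Qed.

(* At the infimum m of the numerical range, T - m is positive but not bounded
   below. *)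
Lemma inf_spectrum T u0 : u0 != 0 -> self_adjoint T ->
  exists2 m, spectrum T m%:C%C & positive_bop (T - m%:B).
Proof.
move=> u00 sT.
have rT u : exists r : R, inner (T u) u = r%:C%C.
  exact/complex_realP/self_adjoint_real.
pose E := [set complex.Re (inner (T u) u) | u in [set u : H | `|u| = 1]].
have E0 : E !=set0.
  exists (complex.Re (inner (T (`|u0|^-1 *: u0)) (`|u0|^-1 *: u0))).
  by exists (`|u0|^-1 *: u0) => //=; rewrite normrZ normfV normr_id mulVf ?normr_eq0.
have [M M0 TM] := bop_bounded_pos T.
have [_ TM'] := self_adjoint_bound sT TM.
have hE : has_inf E.
  split=> //; exists (- M) => _ [u /= u1 <-].
  have := TM' u; rewrite bopDE bop_scalarE innerDl innerZl -normr_inner u1.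
  have [r ->] := rT u; rewrite expr1n mulr1 -rmorphD ler0c /=.
  by rewrite addrC -lerBlDl sub0r.
pose m := inf E.
have pT : positive_bop (T - m%:B).
  apply: ge_scalar_unit => u u1; have [r rE] := rT u.
  rewrite rE lecR; apply: ge_inf; first by case: hE.
  by exists u => //; rewrite rE.
exists m => // -[S [S1 _]].
have [N N0 PN] := bop_bounded_pos (T - m%:B).
have [L L0 SL] := bop_bounded_pos S.
have [pN _] := self_adjoint_bound (positive_self_adjoint pT) PN.
have LN : 0 < L ^+ 2 * N by rewrite mulr_gt0// exprn_gt0.
(* For a unit vector u, 1 <= L^2 |(T - m) u|^2 <= L^2 N <(T - m) u, u>: an inverse bounded by L
   would lift the whole numerical range above its infimum m by 1 / (L^2 N). *)
suff : m + (L ^+ 2 * N)^-1 <= m by rewrite gerDl leNgt invr_gt0 LN.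
apply: lb_le_inf => // _ [u /= u1 <-].
have [r rE] := rT u; rewrite rE /=.
have : 1 <= L%:C%C * `|(T - m%:B) u|.
  rewrite -{1}u1 -[u in leLHS]bop1E -S1 bopME -opprB bopNE linearN normrN.
  exact: SL.
rewrite -(@ler_pXn2r _ 2) ?nnegrE ?mulr_ge0 ?ler0c ?(ltW L0)// expr1n exprMn => le1.
have /(le_trans le1) : L%:C%C ^+ 2 * `|(T - m%:B) u| ^+ 2 <=
    L%:C%C ^+ 2 * (N%:C%C * inner ((T - m%:B) u) u).
  by rewrite ler_wpM2l ?exprn_ge0 ?ler0c ?(ltW L0)// positive_norm_sq.
rewrite bopDE bopNE bop_scalarE innerBl innerZl -normr_inner u1 expr1n mulr1 rE.
rewrite mulrA -rmorphXn -rmorphB -!rmorphM (lecR 1) => ?.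
by rewrite -lerBrDl -[leLHS]mulr1 ler_pdivrMl.
Qed.

(** Completeness of the bounded operators in operator norm: the limit is taken pointwise in H, and
    the uniform Cauchy estimate passes to it. *)
Lemma bop_cauchy (S_ : nat -> bop H) :
  (forall e : R, 0 < e -> exists N : nat, forall m n : nat, (N <= m)%N -> (N <= n)%N ->
    forall u, `|S_ m u - S_ n u| <= e%:C%C * `|u|) ->
  exists S, forall e : R, 0 < e -> exists N : nat, forall n, (N <= n)%N ->
    forall u, `|S u - S_ n u| <= e%:C%C * `|u|.
Proof.
move=> cS.
have cvgS u : cvg (S_ n u @[n --> \oo]).
  apply/cauchy_cvgP/cauchy_exP => e e0.
  have [r rE] : exists r : R, e = r%:C%C by exact/complex_realP/gtr0_real.
  have [s sE] : exists s : R, `|u| = s%:C%C by exact/complex_realP/normr_real.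
  have s0 : 0 <= s by rewrite -ler0c -sE.
  have r0 : 0 < r by rewrite -(ltcR 0) -rE.
  have [N NP] := cS _ (divr_gt0 r0 (ltr_pwDr ltr01 s0)).
  exists (S_ N u); exists N => // n /= Nn; rewrite -ball_normE /=.
  rewrite (le_lt_trans (NP N n _ Nn u))// sE rE -rmorphM ltcR.
  by rewrite mulrAC ltr_pdivrMr ?ltr_pwDr// mulrDr mulr1 ltrDl.
pose L u := lim (S_ n u @[n --> \oo]).
have cvgL u : S_ n u @[n --> \oo] --> L u by exact: cvgS.
have L_near e : 0 < e -> exists N : nat, forall n, (N <= n)%N ->
    forall u, `|L u - S_ n u| <= e%:C%C * `|u|.
  move=> e0; have [|N NP] := cS (e / 2); first by rewrite divr_gt0.
  exists N => n Nn u.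
  (* At u = 0 the tolerance [(e / 2) * |u|] vanishes, and pointwise convergence yields no index for
     it. *)
  have [->|u0] := eqVneq u 0.
    suff -> : L 0 = 0 by rewrite linear0 subrr normr0 mulr0.
    apply/(@cvg_lim _ (@norm_hausdorff _ _)).
    rewrite (_ : (fun n => _) = fun=> 0); first exact: cvg_cst.
    by apply/funext => k; exact: linear0.
  have eu0 : 0 < (e / 2)%:C%C * `|u| by rewrite mulr_gt0 ?normr_gt0 ?(ltcR 0) ?divr_gt0.
  have /cvgrPdist_le/(_ _ eu0)[K _ KP] := cvgL u.
  have H1 := KP (maxn N K) (leq_maxr _ _).
  have H2 := NP _ _ (leq_maxl N K) Nn u.
  apply: le_trans (ler_distD (S_ (maxn N K) u) _ _) _.
  by rewrite (splitr e) rmorphD mulrDl lerD.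
have linL : linear L.
  move=> a u v; apply/(@cvg_lim _ (@norm_hausdorff _ _)).
  rewrite (_ : (fun n => _) = (fun n => a *: S_ n u + S_ n v)).
    by apply: cvgD => //; apply: cvgZr.
  by apply/funext => n; rewrite linearP.
have bndL : exists M : R[i], forall u, `|L u| <= M * `|u|.
  have [N NP] := L_near _ ltr01.
  have [M M0 SM] := bop_bounded_pos (S_ N).
  exists (1 + M%:C%C) => u; rewrite mulrDl -[L u](subrK (S_ N u)).
  by rewrite (le_trans (ler_normD _ _))// lerD// NP.
have LP : L \in @bounded_operator R H by apply/bounded_operatorP.
by exists (Bop LP) => e e0; have [N NP] := L_near e e0; exists N.
Qed.

(** Left general in the two spaces because it serves both for vectors of H and for complex
    numbers. *)
Lemma norm_le_eps0 (V W : normedZmodType R[i]) (u : V) (v : W) :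
  (forall e : R, 0 < e -> `|u| <= e%:C%C * `|v|) -> u = 0.
Proof.
move=> uv; apply/eqP; rewrite -normr_eq0.
have [r rE] : exists r : R, `|u| = r%:C%C by exact/complex_realP/normr_real.
have [s sE] : exists s : R, `|v| = s%:C%C by exact/complex_realP/normr_real.
have s0 : 0 <= s by rewrite -ler0c -sE.
have : 0 <= r by rewrite -ler0c -rE.
rewrite le_eqVlt => /predU1P[r0|r0]; first by rewrite rE -r0.
have := uv _ (divr_gt0 r0 (ltr_pwDr ltr01 s0)).
rewrite rE sE -rmorphM lecR mulrAC ler_pdivlMr ?ltr_pwDr// mulrDr mulr1 gerDl.
by rewrite leNgt r0.
Qed.

(** From 0 <= T <= q follows |T u|^2 <= q <T u, u> <= q^2 |u|^2. *)
Lemma bop_norm_contraction q T : 0 < q -> positive_bop T ->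
  positive_bop (q%:B - T) -> forall u, `|T u| <= q%:C%C * `|u|.
Proof.
move=> q0 pT pq u.
rewrite -(@ler_pXn2r _ 2) ?nnegrE ?mulr_ge0 ?ler0c ?(ltW q0)//.
apply: le_trans (positive_norm_sq q0 pT pq u) _; rewrite exprMn expr2 -mulrA.
rewrite ler_wpM2l ?ler0c ?(ltW q0)// normr_inner -innerZl -subr_ge0 -innerBl.
exact: pq.
Qed.

(* Neumann series of 1 - T / N. *)
Lemma positive_inv c T : 0 < c -> positive_bop (T - c%:B) -> bop_inv T.
Proof.
move=> c0 pT.
have c0' : 0 <= c%:C%C by rewrite ler0c ltW.
have pT0 : positive_bop T.
  by rewrite -[T](subrK c%:B); apply: positiveD => //; exact/positiveZ/positive1.
have [M M0 TM] := bop_bounded_pos T.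
have [pM _] := self_adjoint_bound (positive_self_adjoint pT0) TM.
(* With this N the bounds c <= T <= M give 0 <= E <= q for E = 1 - T / N, where q = M / N < 1. *)
pose N := M + c; have N0 : 0 < N by exact: addr_gt0.
have [q qE] : exists q, q = M / N by eexists.
have q0 : 0 < q by rewrite qE divr_gt0.
have q1 : q < 1 by rewrite qE ltr_pdivrMr// mul1r ltrDl.
have [E EE] : exists E : bop H, E = 1 - (N^-1)%:C%C *: T by eexists.
have NV : N%:C%C * (N^-1)%:C%C = 1 by rewrite -rmorphM divff// gt_eqF.
have NC0 : 0 <= (N^-1)%:C%C by rewrite ler0c invr_ge0 ltW.
have pE : positive_bop E.
  have -> : E = (N^-1)%:C%C *: ((M%:B - T) + c%:B).
    apply: bop_ext => u; rewrite EE bopZE !bopDE !bopNE bop1E bopZE !bop_scalarE.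
    rewrite addrAC -scalerDl -rmorphD -/N scalerBr scalerA mulrC NV scale1r.
    by [].
  by apply: positiveZ => //; apply: positiveD => //; exact/positiveZ/positive1.
have pqE : positive_bop (q%:B - E).
  have -> : q%:B - E = (N^-1)%:C%C *: (T - c%:B).
    apply: bop_ext => u; rewrite EE bopZE !bopDE !bopNE !bopDE !bopNE bop1E bopZE !bop_scalarE.
    rewrite scalerBr scalerA -rmorphM opprB addrCA; congr (_ + _).
    rewrite -[in LHS](scale1r u) scalerA mulr1 -scalerBl -scaleNr; congr (_ *: _).
    rewrite -(rmorph1 (real_complex R)) -rmorphB -rmorphN; congr (_%:C%C).
    by rewrite qE; move: (lt0r_neq0 N0); rewrite /N => ?; field.
  exact: positiveZ.
have Eq := bop_norm_contraction q0 pE pqE.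
have Eqn k u : `|(E ^+ k) u| <= (q ^+ k)%:C%C * `|u|.
  elim: k => [|k IHk]; first by rewrite !expr0 bop1E mul1r.
  rewrite !exprS bopME; apply: le_trans (Eq _) _.
  by rewrite [(q * _)%:C%C]rmorphM /= -mulrA ler_wpM2l// ler0c ltW.
(* Applied to the telescoped identity [(1 - E) * S_ k = 1 - E ^+ k], this lower bound shows that the
   partial sums are Cauchy. *)
have lowE v : (1 - q)%:C%C * `|v| <= `|(1 - E) v|.
  rewrite rmorphB rmorph1 mulrBl mul1r bopDE bopNE bop1E lerBlDr.
  apply: le_trans (lerD (lexx _) (Eq v)).
  by rewrite -{1}[v](subrK (E v)) ler_normD.
pose S_ k : bop H := \sum_(i < k) E ^+ i.
have ES k : (1 - E) * S_ k = 1 - E ^+ k.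
  by rewrite -opprB mulNr -subrX1 opprB.
have SE k : S_ k * (1 - E) = 1 - E ^+ k.
  rewrite -ES; apply: commr_sym; apply: commr_sum => i _.
  by apply: commrX; apply: commr_sym; apply: commrB; [exact: commr1|].
have q_small e : 0 < e -> exists K : nat, forall k, (K <= k)%N -> q ^+ k <= e.
  move=> e0; have /cvgrPdist_le/(_ _ e0)[K _ KP] : q ^+ k @[k --> \oo] --> (0 : R).
    by apply: cvg_expr; rewrite gtr0_norm.
  exists K => k /KP; rewrite sub0r normrN ger0_norm// exprn_ge0// ltW//.
have q1' : 0 < 1 - q by rewrite subr_gt0.
have [|S SP] := @bop_cauchy S_.
  move=> e e0; have [|K KP] := q_small (e * (1 - q) / 2); first by rewrite !divr_gt0 ?mulr_gt0.
  exists K => m n Km Kn u.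
  rewrite -(@ler_pM2l _ (1 - q)%:C%C) ?(ltcR 0)//; apply: le_trans (lowE _) _.
  rewrite bop_appB -!bopME !ES !bopDE !bopNE opprB addrC addrA subrK.
  apply: le_trans (ler_normB _ _) _.
  apply: le_trans (lerD (Eqn _ _) (Eqn _ _)) _.
  rewrite -mulrDl mulrA ler_wpM2r// -rmorphD -rmorphM lecR.
  have := KP m Km; have := KP n Kn; lra.
have small e : 0 < e -> exists k : nat, (forall u, `|S u - S_ k u| <= e%:C%C * `|u|)
    /\ forall u, `|(E ^+ k) u| <= e%:C%C * `|u|.
  move=> e0; have [K1 K1P] := SP e e0; have [K2 K2P] := q_small e e0.
  exists (maxn K1 K2); split=> u; first exact/K1P/leq_maxl.
  by rewrite (le_trans (Eqn _ _))// ler_wpM2r// lecR K2P// leq_maxr.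
(* The tolerance [e / (C + 1)] absorbs the factor [1 - E] when S is replaced by a partial sum. *)
have [C C0 EC] := bop_bounded_pos (1 - E).
have eC e u : (e / (C + 1))%:C%C * (C%:C%C * `|u|) +
    (e / (C + 1))%:C%C * `|u| = e%:C%C * `|u|.
  rewrite mulrA -mulrDl -rmorphM -rmorphD; congr (_%:C%C * _).
  by field; rewrite gt_eqF// addr_gt0.
have inv1 : S * (1 - E) = 1.
  apply: bop_ext => u; apply/eqP; rewrite -subr_eq0; apply/eqP/(@norm_le_eps0 _ _ _ u) => e e0.
  have [|k [kS kE]] := small (e / (C + 1)); first by rewrite divr_gt0// addr_gt0.
  rewrite bopME bop1E.
  rewrite (_ : _ - u = (S ((1 - E) u) - S_ k ((1 - E) u)) - (E ^+ k) u); last first.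
    by rewrite -[S_ k _]bopME SE bopDE bopNE bop1E opprB addrA addrAC addrK.
  apply: le_trans (ler_normB _ _) _; apply: le_trans (lerD (kS _) (kE _)) _.
  by rewrite -(eC e u) lerD2r ler_wpM2l// ler0c divr_ge0 ?addr_ge0// ltW.
have inv2 : (1 - E) * S = 1.
  apply: bop_ext => u; apply/eqP; rewrite -subr_eq0; apply/eqP/(@norm_le_eps0 _ _ _ u) => e e0.
  have [|k [kS kE]] := small (e / (C + 1)); first by rewrite divr_gt0// addr_gt0.
  rewrite bopME bop1E.
  rewrite (_ : _ - u = (1 - E) (S u - S_ k u) - (E ^+ k) u); last first.
    rewrite bop_appB -[(1 - E) (S_ k u)]bopME ES !bopDE !bopNE bop1E.
    by rewrite opprB addrA addrAC addrK.
  apply: le_trans (ler_normB _ _) _; apply: le_trans (lerD (EC _) (kE _)) _.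
  by rewrite -(eC e u) lerD2r [leRHS]mulrCA ler_wpM2l// ler0c ltW.
have -> : T = N%:C%C *: (1 - E).
  by rewrite EE opprB addrCA subrr addr0 scalerA NV scale1r.
apply: bop_invZ; last by exists S.
by rewrite -(rmorph0 (real_complex R)) (inj_eq (@complexI _)) gt_eqF.
Qed.

End Spectrum.

(** * Spectral mapping *)

Section Polynomials.
Context {R : realType} {H : hilbertType R}.
Implicit Types (u v w : H) (z : R[i]) (T S A B : bop H) (b c t : R).

Lemma bop_invN A : bop_inv A -> bop_inv (- A).
Proof. by rewrite -scaleN1r; apply: bop_invZ; rewrite oppr_eq0 oner_eq0. Qed.

Lemma bop_scalarB b c : (b - c)%:B = b%:B - c%:B :> bop H.
Proof. by rewrite /bop_scalar rmorphB scalerBl. Qed.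

(** For z = a + i b with b nonzero, put X = a - T. The commuting factors X + i b and X - i b have
    product X^2 + b^2 >= b^2 > 0, which is invertible; hence so is X + i b = z - T. *)
Lemma spectrum_real T z : self_adjoint T -> spectrum T z -> exists t, z = t%:C%C.
Proof.
move=> sT zT; exists (complex.Re z).
suff b0 : complex.Im z = 0 by case: z b0 {zT} => a b /= ->.
apply: contrapT => /eqP b0; apply: zT.
have -> : z = (complex.Re z)%:C%C + 'i * (complex.Im z)%:C%C by exact: complexE.
move: (complex.Re z) (complex.Im z) b0 => a b b0.
pose X := a%:B - T; pose j := ('i * b%:C%C) *: (1 : bop H).
have -> : (a%:C%C + 'i * b%:C%C) *: (1 : bop H) - T = X + j by rewrite scalerDl addrAC.
have Xj : X * j = j * X by rewrite bop_scaleAr bop_scaleAl mulr1 mul1r.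
have jj : j * j = - (b ^+ 2)%:B.
  rewrite bop_scaleAr bop_scaleAl mulr1 scalerA -scaleNr; congr (_ *: _).
  by rewrite rmorphXn /= -expr2 exprMn sqrCi mulN1r.
have XX (Y k D : bop H) : Y * k = k * Y -> k * k = - D ->
    (Y + k) * (Y - k) = Y * Y + D /\ (Y - k) * (Y + k) = Y * Y + D.
  move=> Yk kk; rewrite !mulrDl !mulrDr !mulNr !mulrN kk Yk opprK.
  by rewrite [Y * Y + k * Y]addrC !addrA subrK [k * Y + _]addrC addrK.
have [XX1 XX2] := XX _ _ _ Xj jj.
apply: (@bop_inv_factor _ _ _ (X - j)); first by rewrite XX1 XX2.
rewrite XX1; apply: (@positive_inv _ _ (b ^+ 2)); first by rewrite exprn_even_gt0.
have sX : self_adjoint X.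
  by apply: self_adjointD; [exact/self_adjointZ/self_adjoint1|exact: self_adjointN].
by rewrite addrK => u; rewrite bopME sX -normr_inner exprn_ge0.
Qed.

(** For t < b the operator T - t is at least b - t > 0, hence invertible; for t > c the same holds
    of t - T. *)
Lemma spectrum_bounds T b c t : positive_bop (T - b%:B) -> positive_bop (c%:B - T) ->
  spectrum T t%:C%C -> b <= t <= c.
Proof.
move=> bT Tc tT; apply/andP; split; rewrite leNgt; apply/negP => lt; apply: tT.
  rewrite -opprB; apply: bop_invN; apply: (@positive_inv _ _ (b - t)).
    by rewrite subr_gt0.
  by rewrite -[_ *: _]/(t%:B) bop_scalarB opprB addrA subrK.
apply: (@positive_inv _ _ (t - c)); first by rewrite subr_gt0.
by rewrite -[_ *: _]/(t%:B) bop_scalarB opprB addrC addrA subrK.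
Qed.

(** Complex coefficients allow polynomials to be split into linear factors; [poly_bop] is recovered
    by embedding real coefficients. *)
Definition cpoly_bop (p : {poly R[i]}) T : bop H := \sum_(i < size p) p`_i *: T ^+ i.

Section Fixed.
Variable T : bop H.
Implicit Types p q : {poly R[i]}.

Lemma cpoly_bop_widen n p : (size p <= n)%N ->
  cpoly_bop p T = \sum_(i < n) p`_i *: T ^+ i.
Proof.
move=> pn; rewrite /cpoly_bop (big_ord_widen n (fun i => p`_i *: T ^+ i))//.
rewrite big_mkcond; apply: eq_bigr => i _; case: ltnP => // pi.
by rewrite nth_default ?scale0r.
Qed.

Lemma cpoly_bopD p q : cpoly_bop (p + q) T = cpoly_bop p T + cpoly_bop q T.
Proof.
rewrite (cpoly_bop_widen (leq_maxl (size p) (size q))).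
rewrite (cpoly_bop_widen (leq_maxr (size p) (size q))).
rewrite (cpoly_bop_widen (size_polyD p q)) -big_split.
by apply: eq_bigr => i _; rewrite coefD scalerDl.
Qed.

Lemma cpoly_bopZ z p : cpoly_bop (z *: p) T = z *: cpoly_bop p T.
Proof.
rewrite (cpoly_bop_widen (size_scale_leq z p)) scaler_sumr.
by apply: eq_bigr => i _; rewrite coefZ scalerA.
Qed.

Lemma cpoly_bopC z : cpoly_bop z%:P T = z *: (1 : bop H).
Proof.
by rewrite (cpoly_bop_widen (size_polyC_leq1 z)) big_ord1 coefC expr0.
Qed.

Lemma cpoly_bopMX p : cpoly_bop (p * 'X) T = cpoly_bop p T * T.
Proof.
have sz : (size (p * 'X)%R <= (size p).+1)%N.
  by rewrite (leq_trans (size_polyMleq _ _))// size_polyX addn2.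
rewrite (cpoly_bop_widen sz) big_ord_recl coefMX /= scale0r add0r mulr_suml.
by apply: eq_bigr => i _; rewrite coefMX /= bop_scaleAl exprSr.
Qed.

Lemma cpoly_bopM p q : cpoly_bop (p * q) T = cpoly_bop p T * cpoly_bop q T.
Proof.
elim/poly_ind: q => [|q c IHq].
  rewrite mulr0 (_ : cpoly_bop 0 T = 0) ?mulr0//.
  by rewrite /cpoly_bop size_poly0 big_ord0.
rewrite mulrDr mulrA [p * c%:P]mulrC mul_polyC !cpoly_bopD !cpoly_bopMX.
by rewrite IHq cpoly_bopZ cpoly_bopC mulrDr mulrA bop_scaleAr mulr1.
Qed.

Lemma cpoly_bop_prod_inv (rs : seq R[i]) :
  {in rs, forall z, bop_inv (z *: (1 : bop H) - T)} ->
  bop_inv (cpoly_bop (\prod_(z <- rs) ('X - z%:P)) T).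
Proof.
elim: rs => [|z rs IHrs] rsT.
  rewrite big_nil cpoly_bopC scale1r.
  by exists 1; rewrite mulr1.
rewrite big_cons cpoly_bopM; apply: bop_invM; last first.
  by apply: IHrs => y yrs; apply: rsT; rewrite inE yrs orbT.
rewrite -polyCN cpoly_bopD cpoly_bopC -['X]mul1r cpoly_bopMX cpoly_bopC scale1r mul1r.
by rewrite scaleNr -opprB; apply/bop_invN/rsT; rewrite inE eqxx.
Qed.

(* a - p(T) factors through the T - z for z a root of a - p. *)
Lemma spectral_mapping p z0 z : spectrum T z0 -> spectrum (cpoly_bop p T) z ->
  exists2 y, spectrum T y & p.[y] = z.
Proof.
(* When p is the constant z there are no roots to factor through; any point of the spectrum then
   serves, here z0. *)
move=> z0T zp; have [pz|pz0] := eqVneq (z%:P - p) 0.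
  exists z0 => //; have -> : p = z%:P by apply/esym/eqP; rewrite -subr_eq0 pz.
  by rewrite hornerC.
apply: contrapT => noroot; apply: zp.
have -> : z *: (1 : bop H) - cpoly_bop p T = cpoly_bop (z%:P - p) T.
  by rewrite cpoly_bopD cpoly_bopC -[- p]scaleN1r cpoly_bopZ scaleN1r.
have [rs rsE] := closed_field_poly_normal (z%:P - p).
rewrite rsE cpoly_bopZ; apply: bop_invZ; first by rewrite lead_coef_eq0.
apply: cpoly_bop_prod_inv => y yrs; apply: contrapT => yT; apply: noroot.
exists y => //; apply/esym/eqP; rewrite -subr_eq0 -[z](hornerC z y) -hornerN -hornerD.
by rewrite rsE hornerZ (rootP _) ?mulr0// root_prod_XsubC.
Qed.

End Fixed.

Implicit Types p q : {poly R}.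

Lemma poly_bopE p T : poly_bop p T = cpoly_bop (map_poly (real_complex R) p) T.
Proof.
rewrite /poly_bop /cpoly_bop size_map_poly; apply: eq_bigr => i _.
by rewrite coef_map.
Qed.

Lemma poly_bopD p q T : poly_bop (p + q) T = poly_bop p T + poly_bop q T.
Proof. by rewrite !poly_bopE rmorphD cpoly_bopD. Qed.

Lemma poly_bopM p q T : poly_bop (p * q) T = poly_bop p T * poly_bop q T.
Proof. by rewrite !poly_bopE rmorphM cpoly_bopM. Qed.

Lemma poly_bopC c T : poly_bop c%:P T = c%:B.
Proof. by rewrite !poly_bopE map_polyC cpoly_bopC. Qed.

Lemma poly_bopX T : poly_bop 'X T = T.
Proof.
by rewrite poly_bopE map_polyX -['X]mul1r cpoly_bopMX cpoly_bopC scale1r mul1r.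
Qed.

Lemma poly_bopN p T : poly_bop (- p) T = - poly_bop p T.
Proof. by apply/eqP; rewrite -addr_eq0 -poly_bopD addNr poly_bopC /bop_scalar scale0r. Qed.

Lemma poly_bop_positive p T : self_adjoint T ->
  (forall t, spectrum T t%:C%C -> 0 <= p.[t]) -> positive_bop (poly_bop p T).
Proof.
move=> sT p0 u.
have [->|u0] := eqVneq u 0; first by rewrite linear0r.
have [m mp mP] := inf_spectrum u0 (poly_bop_self_adjoint p sT).
have [m0 m0T _] := inf_spectrum u0 sT.
rewrite poly_bopE in mp; have [z zT] := spectral_mapping m0T mp.
have [t zE] := spectrum_real sT zT; rewrite zE in zT *.
rewrite horner_map => /complexI ptm.
move/ge_scalarP : mP => /(_ u); apply: le_trans.
by rewrite mulr_ge0 ?exprn_ge0// ler0c -ptm p0.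
Qed.

(** Positivity of e^2 - p^2 on the spectrum gives |p(T) u|^2 = <p(T)^2 u, u> <= e^2 |u|^2. *)
Lemma poly_bop_norm p T (e : R) : self_adjoint T -> 0 <= e ->
  (forall t, spectrum T t%:C%C -> `|p.[t]| <= e) ->
  forall u, `|poly_bop p T u| <= e%:C%C * `|u|.
Proof.
move=> sT e0 pe u.
rewrite -(@ler_pXn2r _ 2) ?nnegrE ?mulr_ge0 ?ler0c// exprMn.
have : positive_bop (poly_bop ((e ^+ 2)%:P - p * p) T).
  apply: poly_bop_positive => // t /pe; rewrite !hornerE subr_ge0 -expr2 => H1.
  by rewrite -[leLHS]real_normK ?num_real// ler_pXn2r// nnegrE.
move=> /(_ u); rewrite poly_bopD poly_bopN poly_bopC poly_bopM.
rewrite bopDE bopNE bopME innerBl innerZl subr_ge0.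
by rewrite (poly_bop_self_adjoint p sT) -!normr_inner rmorphXn.
Qed.

End Polynomials.

(** * Continuous functional calculus *)

Section FunctionalCalculus.
Context {R : realType} {H : hilbertType R}.
Implicit Types (u v w : H) (T S : bop H) (b c t e : R) (f g : R -> R).

(** Polynomials within 1/(n + 1) of f on [b, c], which contains the spectrum, give a Cauchy sequence
    of operators by [poly_bop_norm]. *)
Lemma is_cfc_exists T f b c : self_adjoint T -> positive_bop (T - b%:B) ->
  positive_bop (c%:B - T) -> {within `[b, c], continuous f} -> exists S, is_cfc f T S.
Proof.
move=> sT bT Tc fc.
have en0 n : 0 < (n.+1%:R)^-1 :> R by rewrite invr_gt0.
have [p pP] := choice (fun n => weierstrass fc (en0 n)).
have inbc t : spectrum T t%:C%C -> t \in `[b, c].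
  by move=> tT; rewrite in_itv /=; exact: spectrum_bounds tT.
have small e : 0 < e -> exists N : nat, forall n, (N <= n)%N -> (n.+1%:R)^-1 <= e.
  move=> e0; exists (Num.truncn e^-1) => n Nn.
  rewrite invf_ple ?posrE// ltW// (lt_le_trans (truncnS_gt _))// ler_nat.
  by rewrite ltnS.
have [|S SP] := @bop_cauchy _ _ (fun n => poly_bop (p n) T).
  move=> e e0; have [|N NP] := small (e / 2); first by rewrite divr_gt0.
  exists N => m n Nm Nn u.
  rewrite -bopNE -bopDE -poly_bopN -poly_bopD; apply: poly_bop_norm => //.
    exact: ltW.
  move=> t /inbc tbc; rewrite hornerD hornerN.
  have := le_trans (pP m t tbc) (NP m Nm).
  have := le_trans (pP n t tbc) (NP n Nn).
  by rewrite !ler_norml => /andP[? ?] /andP[? ?]; apply/andP; split; lra.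
exists S, p; split=> e e0.
  have [N NP] := small e e0; exists N => // n /= Nn t /inbc tbc.
  by rewrite (le_trans (pP n t tbc))// NP.
by have [N NP] := SP e e0; exists N.
Qed.

(** [cfc] is a choice among the limits, so existence yields its specification; the later arguments
    go through [is_cfc]. *)
Lemma cfcP T f b c : self_adjoint T -> positive_bop (T - b%:B) ->
  positive_bop (c%:B - T) -> {within `[b, c], continuous f} -> is_cfc f T (cfc f T).
Proof. by move=> sT bT Tc fc; apply: xgetPex; exact: (is_cfc_exists sT bT Tc fc). Qed.

Lemma is_cfc_poly (p : {poly R}) T : is_cfc (fun t => p.[t]) T (poly_bop p T).
Proof.
exists (fun=> p); split=> e e0; apply: nearW => n.
  by move=> t _; rewrite subrr normr0 ltW.
by move=> u; rewrite subrr normr0 mulr_ge0// ler0c ltW.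
Qed.

Lemma is_cfcD f g T S S' : is_cfc f T S -> is_cfc g T S' ->
  is_cfc (fun t => f t + g t) T (S + S').
Proof.
move=> [p [pf pS]] [q [qg qS]]; exists (fun n => p n + q n); split=> e e0.
  have e20 : 0 < e / 2 by rewrite divr_gt0.
  apply: filterS2 (pf _ e20) (qg _ e20) => n pn qn t tT.
  have := pn t tT; have := qn t tT; rewrite hornerD !ler_norml.
  by move=> /andP[? ?] /andP[? ?]; apply/andP; split; lra.
have e20 : 0 < e / 2 by rewrite divr_gt0.
apply: filterS2 (pS _ e20) (qS _ e20) => n pn qn u.
rewrite poly_bopD !bopDE opprD addrACA (le_trans (ler_normD _ _))//.
by rewrite (splitr e) rmorphD mulrDl lerD.
Qed.

Lemma is_cfcZ c f T S : is_cfc f T S -> is_cfc (fun t => c * f t) T (c%:C%C *: S).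
Proof.
move=> [p [pf pS]]; exists (fun n => c *: p n); split=> e e0.
  (* The added 1 covers c = 0. *)
  have ec0 : 0 < e / (`|c| + 1) by rewrite divr_gt0// ltr_pwDr.
  apply: filterS (pf _ ec0) => n pn t tT.
  rewrite hornerZ -mulrBr normrM.
  apply: le_trans (ler_wpM2l (normr_ge0 _) (pn t tT)) _.
  rewrite mulrC mulrAC ler_pdivrMr ?ltr_pwDr//.
  by rewrite ler_wpM2l ?ler_wpDr// ltW.
have ec0 : 0 < e / (`|c| + 1) by rewrite divr_gt0// ltr_pwDr.
apply: filterS (pS _ ec0) => n pn u.
rewrite -mul_polyC poly_bopM poly_bopC bopZE bopME bop_scalarE -scalerBr normrZ.
have -> : `|c%:C%C| = `|c|%:C%C.
  have [c0|c0] := leP 0 c; first by rewrite !ger0_norm ?ler0c.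
  by rewrite !ltr0_norm ?(ltcR _ 0) ?rmorphN.
apply: le_trans (ler_wpM2l _ (pn u)) _; first by rewrite ler0c.
rewrite mulrA -rmorphM ler_wpM2r// lecR mulrC mulrAC ler_pdivrMr ?ltr_pwDr//.
by rewrite ler_wpM2l ?ler_wpDr// ltW.
Qed.

(** One constant M bounds both the operator T and its spectrum, so multiplying by T costs a factor M
    in both approximations. *)
Lemma is_cfcMX f T S : self_adjoint T -> is_cfc f T S ->
  is_cfc (fun t => f t * t) T (S * T).
Proof.
move=> sT [p [pf pS]]; have [M M0 TM] := bop_bounded_pos T.
have [MT TM'] := self_adjoint_bound sT TM.
have tM t : spectrum T t%:C%C -> `|t| <= M.
  rewrite ler_norml; apply: spectrum_bounds => //.
  by rewrite -[X in T - X]opprK /bop_scalar rmorphN scaleNr !opprK.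
exists (fun n => p n * 'X); split=> e e0.
  have eM0 : 0 < e / M by rewrite divr_gt0.
  apply: filterS (pf _ eM0) => n pn t tT.
  rewrite hornerM hornerX -mulrBl normrM.
  by rewrite (le_trans (ler_pM _ _ (pn t tT) (tM t tT)))// divfK// gt_eqF.
have eM0 : 0 < e / M by rewrite divr_gt0.
apply: filterS (pS _ eM0) => n pn u.
rewrite poly_bopM poly_bopX !bopME; apply: le_trans (pn _) _.
apply: le_trans (ler_wpM2l _ (TM u)) _; first by rewrite ler0c ltW.
by rewrite mulrA -rmorphM divfK// gt_eqF.
Qed.

(** A single polynomial achieves both approximations, which reduces claims on <S u, u> to
    polynomials in T. *)
Lemma is_cfc_inner f T S u e : is_cfc f T S -> 0 < e -> exists p : {poly R},
  (forall t, spectrum T t%:C%C -> `|f t - p.[t]| <= e) /\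
  `|inner (S u) u - inner (poly_bop p T u) u| <= e%:C%C * `|u| ^+ 2.
Proof.
move=> [p [pf pS]] e0; have [N1 _ fN] := pf _ e0; have [N2 _ SN] := pS _ e0.
exists (p (maxn N1 N2)); split; first exact/fN/leq_maxl.
have Sn := SN (maxn N1 N2) (leq_maxr _ _) u; rewrite -innerBl.
apply: le_trans (Cauchy_Schwarz _ _) _.
by rewrite expr2 mulrA ler_wpM2r.
Qed.

(** <S u, u> is arbitrarily close to the real numbers <p(T) u, u>, hence real. *)
Lemma is_cfc_self_adjoint f T S : self_adjoint T -> is_cfc f T S -> self_adjoint S.
Proof.
move=> sT fS; apply: real_self_adjoint => u; apply/CrealP/eqP; rewrite -subr_eq0.
apply/eqP/(@norm_le_eps0 _ _ _ _ (`|u| ^+ 2)) => e e0.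
have [|p [_ ple]] := is_cfc_inner u fS (e := e / 2); first by rewrite divr_gt0.
have /CrealP aR := self_adjoint_real u (poly_bop_self_adjoint p sT).
set z := inner (S u) u in ple *; set a := inner _ u in ple aR.
rewrite (_ : z^* - z = (z - a)^* - (z - a)); last by rewrite rmorphB /= aR; ring.
rewrite (le_trans (ler_normB _ _))// norm_conjC normrX normr_id.
by rewrite [in leRHS](splitr e) rmorphD mulrDl lerD.
Qed.

(** If p is within e/4 of f >= 0, then p + e/4 is nonnegative on the spectrum, so <S u, u> lies
    within (e/2) |u|^2 of a nonnegative number. Nonnegativity of the complex number z is obtained as
    |z| = z. *)
Lemma is_cfc_positive f T S : self_adjoint T -> is_cfc f T S ->
  (forall t, spectrum T t%:C%C -> 0 <= f t) -> positive_bop S.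
Proof.
move=> sT fS f0 u; set z := inner (S u) u.
suff /eqP : `|z| - z = 0 by rewrite subr_eq0 => /eqP <-.
apply: (@norm_le_eps0 _ _ _ _ (`|u| ^+ 2)) => e e0.
have e40 : 0 < e / 4 by rewrite divr_gt0.
have [p [pf ple]] := is_cfc_inner u fS e40.
have : positive_bop (poly_bop (p + (e / 4)%:P) T).
  apply: poly_bop_positive => // t tT; rewrite hornerD hornerC.
  by have := pf t tT; have := f0 t tT; rewrite ler_norml => ? /andP[? ?]; lra.
move=> /(_ u); rewrite poly_bopD poly_bopC bopDE bop_scalarE innerDl innerZl -normr_inner.
set a := inner _ u + _ => a0.
have za : `|z - a| <= (e / 2)%:C%C * `|u| ^+ 2.
  rewrite /a opprD addrA (le_trans (ler_normB _ _))//.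
  rewrite (_ : e / 2 = e / 4 + e / 4); last by field.
  rewrite rmorphD mulrDl lerD// ger0_norm// mulr_ge0 ?exprn_ge0//.
  by rewrite ler0c ltW.
rewrite normrX normr_id (splitr e) rmorphD mulrDl.
apply: le_trans (ler_distD a _ _) _; apply: lerD; last by rewrite distrC.
by have := le_trans (ler_dist_dist z a) za; rewrite (ger0_norm a0).
Qed.

End FunctionalCalculus.

(** * Tangent inequalities for operators *)

Section Tangents.
Context {R : realType} {H : hilbertType R}.
Implicit Types (T S F : bop H) (J : interval R) (f : R -> R) (s t b c : R).

Lemma spectrumN T t : spectrum (- T) t%:C%C -> spectrum T (- t)%:C%C.
Proof.
move=> tT invT; apply: tT.
have -> : t%:C%C *: (1 : bop H) - - T = - ((- t)%:C%C *: (1 : bop H) - T).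
  by rewrite opprB rmorphN scaleNr !opprK addrC.
exact: bop_invN.
Qed.

(** The ends b and c come from [inf_spectrum] at T and at -T. As points of the spectrum they lie in
    J, so f and f' are continuous on [b, c] even if J is not closed. *)
Lemma spectrum_in_segment T J (u0 : H) : u0 != 0 -> self_adjoint T -> spectrum_in T J ->
  exists b c, [/\ b \in J, c \in J, positive_bop (T - b%:B) & positive_bop (c%:B - T)].
Proof.
move=> u00 sT TJ.
have [b /TJ[b' b'J /complexI bE] bT] := inf_spectrum u00 sT.
have [c /spectrumN/TJ[c' c'J /complexI cE] cT] := inf_spectrum u00 (self_adjointN sT).
exists b', c'; split=> //; first by rewrite bE.
by rewrite cE /bop_scalar rmorphN scaleNr -opprD addrC opprD.
Qed.

(** The operator is the functional calculus of f(t) - (a + b t) at T. *)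
Lemma affine_le_cfc f T F (a b : R) : self_adjoint T -> is_cfc f T F ->
  (forall t, spectrum T t%:C%C -> a + b * t <= f t) ->
  positive_bop (F - (a%:B + b%:C%C *: T)).
Proof.
move=> sT fF le.
have := is_cfcD fF (is_cfc_poly (- (a%:P + b%:P * 'X)) T).
rewrite poly_bopN poly_bopD poly_bopM !poly_bopC poly_bopX.
rewrite [b%:B * T]bop_scaleAl mul1r => /(is_cfc_positive sT); apply => t /le.
by rewrite hornerN hornerD hornerM !hornerC hornerX subr_ge0.
Qed.

(** Here s is fixed and t is the variable of the calculus: the operator corresponds to r - f(t) -
    f'(t) (s - t), the term f'(t) t becoming [F' * T]. *)
Lemma tangent_le_cfc f (f' : R -> R) T F F' s r : self_adjoint T ->
  is_cfc f T F -> is_cfc f' T F' ->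
  (forall t, spectrum T t%:C%C -> f t + f' t * (s - t) <= r) ->
  positive_bop (r%:B - (F + (s%:C%C *: F' - F' * T))).
Proof.
move=> sT fF fF' le.
have := is_cfcD (is_cfcD (is_cfcZ (-1) fF) (is_cfcZ (- s) fF'))
  (is_cfcD (is_cfcMX sT fF') (is_cfc_poly r%:P T)).
move=> /(is_cfc_positive sT) pos.
have -> : r%:B - (F + (s%:C%C *: F' - F' * T)) =
    (-1)%:C%C *: F + (- s)%:C%C *: F' + (F' * T + poly_bop r%:P T).
  rewrite poly_bopC !rmorphN rmorph1 !scaleNr scale1r !opprD opprK.
  by rewrite addrC -!addrA.
by apply: pos => t /le; rewrite hornerC => ?; lra.
Qed.

End Tangents.

(** T is the difference of the positive operators T + M and M, whose images are positive and so
    self-adjoint. *)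
Lemma positive_map_self_adjoint (R : realType) (H K : hilbertType R)
    (Phi : {linear bop H -> bop K}) (T : bop H) :
  positive_map Phi -> self_adjoint T -> self_adjoint (Phi T).
Proof.
move=> pPhi sT; have [M M0 TM] := bop_bounded_pos T.
have [_ pT] := self_adjoint_bound sT TM.
rewrite -[T](addrK M%:B) linearB; apply: self_adjointD.
  exact/positive_self_adjoint/pPhi.
apply: self_adjointN; rewrite linearZ; apply: self_adjointZ.
exact/positive_self_adjoint/pPhi/positive1.
Qed.

Theorem theorem2p1 (R : realType) (H K : hilbertType R) (n : nat)
    (Phi : 'I_n -> {linear bop H -> bop K}) (A B : 'I_n -> bop H)
    (J : interval R) (f : R -> R)
    (Phi_pos : forall i, positive_map (Phi i))
    (Phi_unital : \sum_i Phi i 1 = 1)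
    (A_sa : forall i, self_adjoint (A i)) (B_sa : forall i, self_adjoint (B i))
    (A_J : forall i, spectrum_in (A i) J) (B_J : forall i, spectrum_in (B i) J)
    (f_C1co : C1co J f) (x : K) (x_unit : `|x| = 1) :
  let f' := deriv_on J f in
  let PA := \sum_i Phi i (A i) in
  let PB := \sum_i Phi i (B i) in
  inner (PA x) x * inner (cfc f' PB x) x - inner ((cfc f' PB * PB) x) x
    <= inner ((\sum_i Phi i (cfc f (A i))) x) x - inner (cfc f PB x) x
  /\
  inner ((\sum_i Phi i (cfc f (A i))) x) x - inner (cfc f PB x) x
    <= inner ((\sum_i Phi i (cfc f' (A i) * A i)) x) x
       - inner ((\sum_i Phi i (cfc f' (A i))) x) x * inner (PB x) x.
Proof.
move=> f' PA PB.
have x0 : x != 0 by rewrite -normr_eq0 x_unit oner_eq0.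
(* If H were zero, or below if n were 0, the sum of the [Phi i 1] would vanish, whereas it fixes the
   nonzero vector x. *)
have [u0 u00] : exists u0 : H, u0 != 0.
  apply: contrapT => noH; move/eqP: x0; apply; rewrite -[x]bop1E -Phi_unital.
  have -> : (1 : bop H) = 0.
    apply: bop_ext => u; rewrite bop1E; apply: contrapT => /eqP u0.
    by apply: noH; exists u.
  by rewrite big1// => i _; rewrite linear0.
have [i0 _] : exists i0 : 'I_n, True.
  apply: contrapT => non; move/eqP: x0; apply; rewrite -[x]bop1E -Phi_unital.
  by rewrite big1// => i _; case: non; exists i.
have sum_Phi_scalar (a : R) : \sum_i Phi i a%:B = a%:B.
  by rewrite /bop_scalar -Phi_unital scaler_sumr; apply: eq_bigr => i _; rewrite linearZ.
have sum_pos (T : 'I_n -> bop H) : (forall i, positive_bop (T i)) ->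
    positive_bop (\sum_i Phi i (T i)).
  move=> pT; elim/big_ind: _ => [u||i _]; [by rewrite linear0l|exact: positiveD|].
  exact/Phi_pos/pT.
have sum_sa (T : 'I_n -> bop H) : (forall i, self_adjoint (T i)) ->
    self_adjoint (\sum_i Phi i (T i)).
  move=> sT; elim/big_ind: _ => [u v||i _]; [by rewrite linear0l linear0r|exact: self_adjointD|].
  exact: positive_map_self_adjoint.
have [bB /choice[cB BP]] := choice (fun i => spectrum_in_segment u00 (B_sa i) (B_J i)).
have [bA /choice[cA AP]] := choice (fun i => spectrum_in_segment u00 (A_sa i) (A_J i)).
(* The least lower and the greatest upper bound of the B_i: all B_i, and by positivity and unitality
   PB too, lie between b and c. Both are attained, hence in J. *)
pose b := bB [arg min_(i < i0) bB i]%O; pose c := cB [arg max_(i > i0) cB i]%O.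
have PB_sa : self_adjoint PB by exact: sum_sa.
have bJ : b \in J by case: (BP [arg min_(i < i0) bB i]%O).
have cJ : c \in J by case: (BP [arg max_(i > i0) cB i]%O).
have scalar_pos (a : R) : 0 <= a -> positive_bop (a%:B : bop H).
  by move=> a0; apply: positiveZ positive1; rewrite ler0c.
have PBb : positive_bop (PB - b%:B).
  rewrite -(sum_Phi_scalar b) -sumrB.
  under eq_bigr do rewrite -linearB.
  apply: sum_pos => i; rewrite -[B i](subrK (bB i)%:B) -addrA -bop_scalarB.
  apply: positiveD; first by case: (BP i).
  by apply: scalar_pos; rewrite subr_ge0 /b; case: arg_minP => // j _; exact.
have PBc : positive_bop (c%:B - PB).
  rewrite -(sum_Phi_scalar c) -sumrB.
  under eq_bigr do rewrite -linearB.
  apply: sum_pos => i; rewrite -(subrK (cB i)%:B c%:B) -addrA -bop_scalarB.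
  apply: positiveD; last by case: (BP i).
  by apply: scalar_pos; rewrite subr_ge0 /c; case: arg_maxP => // j _; exact.
have fA i : is_cfc f (A i) (cfc f (A i)).
  by have [? ? bA' cA'] := AP i; exact:
    (cfcP (A_sa i) bA' cA' (C1co_continuous f_C1co _ _)).
have f'A i : is_cfc f' (A i) (cfc f' (A i)).
  by have [? ? bA' cA'] := AP i; exact:
    (cfcP (A_sa i) bA' cA' (deriv_on_continuous f_C1co _ _)).
have fB : is_cfc f PB (cfc f PB) := cfcP PB_sa PBb PBc (C1co_continuous f_C1co bJ cJ).
have f'B : is_cfc f' PB (cfc f' PB) := cfcP PB_sa PBb PBc (deriv_on_continuous f_C1co bJ cJ).
have A_J' i t : spectrum (A i) t%:C%C -> t \in J.
  by move=> /A_J[t' ? /complexI <-].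
have PB_J t : spectrum PB t%:C%C -> t \in J.
  by move=> tPB; apply: (itv_segment bJ cJ); rewrite in_itv /=; exact: spectrum_bounds tPB.
(* All inner products involved belong to self-adjoint operators, so the inequalities in [R[i]]
   reduce to inequalities in R. *)
have inner_real T : self_adjoint T -> exists r : R, inner (T x) x = r%:C%C.
  by move=> sT; exact/complex_realP/self_adjoint_real.
have [p pE] := inner_real _ (sum_sa A A_sa).
have [q qE] := inner_real _ PB_sa.
have [a1 a1E] := inner_real _ (is_cfc_self_adjoint PB_sa fB).
have [a2 a2E] := inner_real _ (is_cfc_self_adjoint PB_sa f'B).
have [a3 a3E] := inner_real _ (is_cfc_self_adjoint PB_sa (is_cfcMX PB_sa f'B)).
have [g1 g1E] := inner_real _ (sum_sa _ (fun i => is_cfc_self_adjoint (A_sa i) (fA i))).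
have [g2 g2E] := inner_real _ (sum_sa _ (fun i => is_cfc_self_adjoint (A_sa i) (f'A i))).
have [g3 g3E] := inner_real _ (sum_sa _ (fun i =>
  is_cfc_self_adjoint (A_sa i) (is_cfcMX (A_sa i) (f'A i)))).
have xx : inner x x = 1 by rewrite -normr_inner x_unit expr1n.
have scalar_x (a : R) : inner (a%:B x) x = a%:C%C by rewrite bop_scalarE innerZl xx mulr1.
have sumB (T S : 'I_n -> bop H) :
    \sum_i Phi i (T i - S i) = \sum_i Phi i (T i) - \sum_i Phi i (S i).
  by rewrite -sumrB; apply: eq_bigr => i _; rewrite linearB.
have sumD (T S : 'I_n -> bop H) :
    \sum_i Phi i (T i + S i) = \sum_i Phi i (T i) + \sum_i Phi i (S i).
  by rewrite -big_split; apply: eq_bigr => i _; rewrite linearD.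
have sumZ (a : R) (T : 'I_n -> bop H) :
    \sum_i Phi i (a%:C%C *: T i) = a%:C%C *: \sum_i Phi i (T i).
  by rewrite scaler_sumr; apply: eq_bigr => i _; rewrite linearZ.
rewrite pE qE a1E a2E a3E g1E g2E g3E -!rmorphM -!rmorphB !lecR; split.
(* Tangents at the points t of the spectrum of PB, paired with x, bound f(s) from below by an affine
   function of s; evaluating it at the A_i gives a1 - a3 + a2 p <= g1. *)
- have le_f s : s \in J -> (a1 - a3) + a2 * s <= f s.
    move=> sJ; have := tangent_le_cfc (r := f s) PB_sa fB f'B (s := s).
    move=> /(_ (fun t tPB => tangent_le f_C1co (PB_J t tPB) sJ)) /(_ x).
    rewrite bopDE bopNE !bopDE bopNE bopZE innerBl !innerDl innerNl innerZl scalar_x.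
    rewrite a1E a2E a3E -rmorphM -rmorphB -rmorphD -rmorphB ler0c => ?; lra.
  have := sum_pos _ (fun i => affine_le_cfc (A_sa i) (fA i) (fun t tA => le_f t (A_J' i t tA))).
  move=> /(_ x); rewrite sumB sumD sumZ sum_Phi_scalar.
  rewrite bopDE bopNE !bopDE bopZE innerBl !innerDl innerZl scalar_x g1E pE.
  by rewrite -rmorphM -rmorphD -rmorphB ler0c => ?; lra.
(* The roles are exchanged: tangents at the spectra of the A_i, then evaluation in s at PB, giving
   g1 - g3 + g2 q <= a1. *)
- have le_f s : s \in J -> (g1 - g3) + g2 * s <= f s.
    move=> sJ; have := sum_pos _ (fun i => tangent_le_cfc (r := f s) (A_sa i) (fA i) (f'A i)
      (fun t tA => tangent_le f_C1co (A_J' i t tA) sJ)).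
    move=> /(_ x); rewrite sumB sumD sumB sumZ sum_Phi_scalar.
    rewrite bopDE bopNE !bopDE bopNE bopZE innerBl !innerDl innerNl innerZl scalar_x.
    rewrite g1E g2E g3E -rmorphM -rmorphB -rmorphD -rmorphB ler0c => ?; lra.
  have := affine_le_cfc PB_sa fB (fun t tPB => le_f t (PB_J t tPB)).
  move=> /(_ x).
  rewrite bopDE bopNE !bopDE bopZE innerBl !innerDl innerZl scalar_x a1E qE.
  by rewrite -rmorphM -rmorphD -rmorphB ler0c => ?; lra.
Qed.
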